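(* Let $K:[0,1]^2\to[0,\infty)$ be a nonnegative kernel with $K(x,\cdot)\in L_1[0,1]$ for all $x\in[0,1]$, such that $$L(f;x):=\int_0^1K(x,t)f(t)\,dt,\qquad f\in C[0,1],\ x\in[0,1],$$ defines an operator $L:C[0,1]\to C[0,1]$. Then $L\circ S_{\Delta_n}\neq B_n$ for every integer $n\ge 2$.
   Context: $C[0,1]$ is the space of real-valued continuous functions on $[0,1]$. The Bernstein operator is $B_n(f;x)=\sum_{k=0}^n f(k/n)\binom nk x^k(1-x)^{n-k}$. $S_{\Delta_n}:C[0,1]\to C[0,1]$ is piecewise linear interpolation at the points $0,\frac1n,\dots,\frac{n-1}{n},1$. *)

(* Defs.v *)
From HB Require Import structures.
From mathcomp Require Import all_boot all_order all_algebra.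
From mathcomp Require Import all_classical all_reals all_analysis.

Set Implicit Arguments.
Unset Strict Implicit.
Unset Printing Implicit Defensive.

Import Order.TTheory GRing.Theory Num.Theory.
Import numFieldNormedType.Exports.

Local Open Scope classical_set_scope.
Local Open Scope ring_scope.

(* An element of C[0,1] is represented by a function f : R -> R whose
   restriction to [0,1] is continuous; its values outside [0,1] are junk, and
   two representatives are identified when they agree on [0,1]. *)
Definition C01 (R : realType) : set (R -> R) :=
  [set f : R -> R | {within `[(0 : R), 1], continuous f}].

(* Equality of operators C[0,1] -> C[0,1]. *)
Definition C01_op_eq (R : realType) (T U : (R -> R) -> R -> R) : Prop :=
  forall f, C01 f -> forall x, x \in `[0, 1] -> T f x = U f x.

Definition bernstein_op (R : realType) (n : nat) (f : R -> R) (x : R) : R :=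
  \sum_(k < n.+1) f (k%:R / n%:R) * 'C(n, k)%:R * x ^+ k * (1 - x) ^+ (n - k).

(* The index k < n of a subinterval [k/n, (k+1)/n] containing x, for x in [0,1];
   the minimum with n - 1 puts x = 1 in the last one. *)
Definition cell_index (R : realType) (n : nat) (x : R) : nat :=
  minn (Num.truncn (n%:R * x)) n.-1.

Definition pl_interp (R : realType) (n : nat) (f : R -> R) (x : R) : R :=
  let k := cell_index n x in
  let a := k%:R / n%:R in
  let b := k.+1%:R / n%:R in
  f a + (f b - f a) / (b - a) * (x - a).

(* Lebesgue measure is taken on the complete sigma-algebra of Lebesgue
   measurable sets; the library's lebesgue_measure only sees Borel sets. *)
Definition L1_01 (R : realType) (g : R -> R) : Prop :=
  (@completed_lebesgue_measure R).-integrable `[0, 1] (EFin \o g).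

Definition kernel_op (R : realType) (K : R -> R -> R) (f : R -> R) (x : R) : R :=
  \int[@completed_lebesgue_measure R]_(t in `[0, 1]) (K x t * f t).

(* On each [k/n, (k+1)/n] the function pl_interp n f is the chord of f; taking
   x at either end also gives the interpolation conditions. *)
Lemma pl_interp_chord (R : realType) (n k : nat) (f : R -> R) (x : R) :
  (k < n)%N -> k%:R / n%:R <= x <= k.+1%:R / n%:R ->
  pl_interp n f x = f (k%:R / n%:R) +
    (n%:R * x - k%:R) * (f (k.+1%:R / n%:R) - f (k%:R / n%:R)).
Proof.
move=> kn; have n0 : 0 < n%:R :> R by rewrite ltr0n (leq_ltn_trans _ kn).
have nN : n%:R != 0 :> R by rewrite gt_eqF.
rewrite ler_pdivrMr// ler_pdivlMr// => /andP[].
rewrite (mulrC x) => kx xk.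
have chord j : (f (j.+1%:R / n%:R) - f (j%:R / n%:R)) /
    (j.+1%:R / n%:R - j%:R / n%:R) * (x - j%:R / n%:R) =
    (n%:R * x - j%:R) * (f (j.+1%:R / n%:R) - f (j%:R / n%:R)).
  have -> : j.+1%:R / n%:R - j%:R / n%:R = n%:R^-1 :> R.
    by rewrite -mulrBl -natrB// subSnn mul1r.
  by rewrite invrK -mulrA (mulrBr n%:R) mulrCA divff// mulr1 mulrC.
rewrite /pl_interp /= chord /cell_index.
move: xk; rewrite le_eqVlt => /predU1P[xE|xk]; last first.
  have -> : Num.truncn (n%:R * x) = k.
    by apply/eqP; rewrite truncn_eq ?kx//= (le_trans _ kx).
  by have /minn_idPl -> : (k <= n.-1)%N by rewrite -ltnS (ltn_predK kn).
rewrite xE natrK; have [kE|kn1] := eqVneq k.+1 n.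
  by have /minn_idPr -> : (n.-1 <= k.+1)%N; rewrite -kE//= kE xE.
have /minn_idPl -> : (k.+1 <= n.-1)%N.
  by rewrite -ltnS (ltn_predK kn) ltn_neqAle kn1.
by rewrite subrr mul0r addr0 -natrB// subSnn mul1r addrC subrK.
Qed.

(* Main.v *)
Require Import Defs.
From HB Require Import structures.
From mathcomp Require Import all_boot all_order all_algebra.
From mathcomp Require Import all_classical all_reals all_analysis.
From mathcomp Require Import measurable_realfun.

Import Order.TTheory GRing.Theory Num.Theory.
Import numFieldNormedType.Exports.

Local Open Scope classical_set_scope.
Local Open Scope ring_scope.

(** The endpoint x = 0 already gives a contradiction. The functions 1 and t are
    their own piecewise linear interpolants, so L o S = B_n would yield
    L(1; 0) = 1 and L(t; 0) = 0. As K(0, t) t >= 0, the second equation forces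
    K(0, t) = 0 for almost all t in [0, 1], which contradicts the first. *)

(** Borel sets are generated by half-open intervals, which are Carathéodory measurable for the outer
    measure built from interval length. *)
Lemma completed_measurable_borel (R : realType) (A : set R) :
  measurable A -> (wlength (R := R) idfun)^*%mu.-cara.-measurable A.
Proof. exact: sub_caratheodory. Qed.

(** Both Lebesgue measures restrict the same outer measure, so the Borel value carries over by
    conversion. *)
Lemma completed_lebesgue_measure_set1 (R : realType) (a : R) :
  @completed_lebesgue_measure R [set a] = 0%E.
Proof. exact: (@lebesgue_measure_set1 R a). Qed.

(** A nonnegative product with zero integral vanishes almost everywhere; off the negligible zero set
    of [h], the factor [g] must then vanish. *)
Lemma ge0_integral_mul_eq0 d (T : measurableType d) (R : realType)
    (mu : {measure set T -> \bar R}) (D : set T) (g h : T -> R) :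
  measurable D -> measurable_fun D g -> measurable_fun D h ->
  (forall t, D t -> 0 <= g t) -> (forall t, D t -> 0 <= h t) ->
  mu.-negligible [set t | D t /\ h t = 0] ->
  (\int[mu]_(t in D) (g t * h t)%:E = 0)%E ->
  (\int[mu]_(t in D) (g t)%:E = 0)%E.
Proof.
move=> mD mg mh g0 h0 hN gh0.
have /measurable_EFinP mgh : measurable_fun D (g \* h) by exact: measurable_funM.
have /(ae_eq_integral_abs mu mD mgh) ghae :
    (\int[mu]_(t in D) `|(g t * h t)%:E| = 0)%E.
  rewrite -[RHS]gh0; apply: eq_integral => t /set_mem Dt.
  by rewrite abse_EFin ger0_norm// mulr_ge0 ?g0 ?h0.
rewrite -[RHS](integral0 mu D); apply: ae_eq_integral => //.
  exact/measurable_EFinP.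
have hN0 : {ae mu, forall t, ~ (D t /\ h t = 0)}.
  by apply: negligibleS hN => t /= /contrapT.
apply: filterS2 ghae hN0 => t + hNt Dt => /(_ Dt) [] /eqP.
by rewrite mulf_eq0 => /orP[/eqP ->//|/eqP ht]; case: hNt.
Qed.

Lemma pl_interp_cst (R : realType) (n : nat) (c x : R) :
  pl_interp n (cst c) x = c.
Proof. by rewrite /pl_interp/= subrr !mul0r addr0. Qed.

Lemma pl_interp_id (R : realType) (n : nat) (x : R) :
  (0 < n)%N -> pl_interp n id x = x.
Proof.
move=> n0; rewrite /pl_interp; set k := cell_index n x.
rewrite /= divff ?mul1r ?subrKC//.
(* The slope is a quotient of equal terms, and the cell width 1/n is nonzero. *)
by rewrite -mulrBl -natrB// subSnn mul1r invr_eq0 pnatr_eq0 -lt0n.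
Qed.

Lemma bernstein_op_at0 (R : realType) (n : nat) (f : R -> R) :
  bernstein_op n f 0 = f 0.
Proof.
rewrite /bernstein_op big_ord_recl/= big1 ?addr0 => [|i _].
  (* Only the term k = 0 survives, through [0 ^+ 0 = 1]. *)
  by rewrite mul0r bin0 expr0 subr0 expr1n !mulr1.
by rewrite exprS mul0r mulr0 mul0r.
Qed.

Theorem mainTheorem4 (R : realType) (K : R -> R -> R)
  (K_ge0 : forall x t : R, x \in `[0, 1] -> t \in `[0, 1] -> 0 <= K x t)
  (K_L1 : forall x : R, x \in `[0, 1] -> L1_01 (K x))
  (K_op : forall f : R -> R, C01 f -> C01 (kernel_op K f))
  (n : nat) (n_ge2 : (2 <= n)%N) :
  ~ C01_op_eq (fun f : R -> R => kernel_op K (pl_interp n f)) (@bernstein_op R n).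
Proof.
move=> LSB; have n0 : (0 < n)%N by exact: ltnW.
have in0 : (0 : R) \in `[0, 1] by rewrite in_itv/= lexx ler01.
have cont1 : C01 (cst (1 : R)) by apply: continuous_subspaceT => x; exact: cvg_cst.
have contX : C01 (id : R -> R) by apply: continuous_subspaceT => x; exact: cvg_id.
have S1 : pl_interp n (cst (1 : R)) = cst 1 by apply/funext => x; exact: pl_interp_cst.
have SX : pl_interp n (id : R -> R) = id by apply/funext => x; exact: pl_interp_id.
have := LSB _ contX _ in0; have := LSB _ cont1 _ in0.
rewrite !bernstein_op_at0 S1 SX /kernel_op /Rintegral /=.
under eq_integral do rewrite mulr1.
move=> intK intKX.
(* [T] is the real line with the Lebesgue sigma-algebra, on which the integrals are taken. *)
pose T := caratheodory_type ((wlength (R := R) idfun)^*)%mu.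
have mI : measurable (`[(0 : R), 1] : set T).
  by apply: completed_measurable_borel; exact: measurable_itv.
have iK := K_L1 _ in0.
have mK : measurable_fun (`[(0 : R), 1] : set T) (K 0).
  exact/measurable_EFinP/(measurable_int _ iK).
have mX : measurable_fun (`[(0 : R), 1] : set T) (id : T -> R).
  move=> _ B mB; apply: measurableI => //.
  exact: completed_measurable_borel.
(* On [0,1] the product is dominated by K(0, t). *)
have iKX : (@completed_lebesgue_measure R).-integrable `[0, 1] (fun t => (K 0 t * t)%:E).
  apply: le_integrable iK => //.
    exact/measurable_EFinP/measurable_funM.
  move=> t /=; rewrite in_itv/= => /andP[t0 t1].
  by rewrite lee_fin normrM ler_piMr// ger0_norm.
(* [fine] also sends infinite values to 0, so [intKX] yields a zero integral only once [iKX] makes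
   it finite. *)
have KX0 : (\int[@completed_lebesgue_measure R]_(t in `[0%R, 1%R]) (K 0 t * t)%:E = 0)%E.
  by rewrite -[LHS]fineK ?intKX//; exact: integrable_fin_num.
have hN : (@completed_lebesgue_measure R).-negligible
    [set t : T | (t : R) \in `[0, 1] /\ (t : R) = 0].
  exists [set 0]; split.
  - by apply: completed_measurable_borel; exact: measurable_set1.
  - exact: completed_lebesgue_measure_set1.
  - by move=> t [].
move: intK; rewrite (ge0_integral_mul_eq0 _ _ _ _ _ _ _ mI mK mX _ _ hN KX0).
- by move/eqP; rewrite eq_sym oner_eq0.
- by move=> t; exact: K_ge0.
- by move=> t /=; rewrite in_itv/= => /andP[].
Qed.
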